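(* Let $f,g:[0,\infty)\to[0,\infty)$ be piecewise-linear homeomorphisms with bounded slopes such that $[f],[g]\in H_{[1,\infty]}:=\bigcup_{M>1}H_{[1,M]}$. Suppose there is a strictly increasing sequence $\{a_n\}$ of positive real numbers such that $f(a_n)=g(a_n)=a_n$ for all $n$, and points $x_n\in(a_n,a_{n+1})$ such that, for each $n$, $x_n$ is the only break point of $f$, and the only break point of $g$, in the interior of $[a_n,a_{n+1}]$. Let $\lambda_n$ and $\lambda'_n$ denote the slopes on $[a_n,x_n]$ of $f$ and $g$ respectively. Suppose there are constants $\epsilon>0$ and $K,K'>1$ such that, for all $n$, $|\lambda_n-1|>\epsilon$, $|\lambda'_n-1|>\epsilon$, $|\lambda_n-\lambda'_n|>\epsilon$, and $$K<\frac{x_n}{a_n}<K',\qquad K<\frac{a_{n+1}}{x_n}<K'.$$ Then for any $h,h'\in H$, the elements $h\circ[f]$ and $h'\circ[g]$ do not commute in $QI(\mathbb{R}_+)$.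
   Context: $\mathbb{R}_+=[0,\infty)$. $QI(\mathbb{R}_+)$ is the group (under composition) of quasi-isometries $\mathbb{R}_+\to\mathbb{R}_+$ modulo the relation of being at bounded distance; $[g]$ denotes the class of $g$. A piecewise-linear homeomorphism has bounded slopes if its set of break points (points of non-differentiability) is discrete and all its slopes lie in $(C^{-1},C)$ for some $C>1$. For $[g]\in QI(\mathbb{R}_+)$ set $$S_{[g]}=\Big\{\lim_{n\to\infty}\tfrac{g(x_n)}{x_n} : x_n\to\infty \text{ and } \tfrac{g(x_n)}{x_n}\text{ converges}\Big\},$$ and for $M\ge1$ let $H_{[1,M]}=\{[g]:S_{[g]}=[1,M]\}$. $H=\{[g]\in QI(\mathbb{R}_+):\lim_{x\to\infty}g(x)/x=1\}$, a normal subgroup of $QI(\mathbb{R}_+)$. *)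

(* Defs.v *)
From HB Require Import structures.
From mathcomp Require Import all_boot all_order all_algebra.
From mathcomp Require Import generic_quotient.
From mathcomp Require Import all_classical all_reals all_analysis.
From mathcomp Require Import lra.

Set Implicit Arguments.
Unset Strict Implicit.
Unset Printing Implicit Defensive.

Import Order.TTheory GRing.Theory Num.Theory.
Import numFieldNormedType.Exports.

Local Open Scope classical_set_scope.
Local Open Scope ring_scope.
Local Open Scope quotient_scope.

(* Maps [0, oo) -> [0, oo) are represented by functions R -> R sending
   [halfline] into itself; their values at negative reals play no role. *)
Definition halfline (R : realType) : set R := `[0, +oo[.

Arguments halfline {R}.

Section QuasiIsometries.
Variable R : realType.
Implicit Types f g : R -> R.

Definition quasi_isometry f :=
  set_fun halfline halfline f /\
  exists k c : R, [/\ 1 <= k, 0 <= c,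
    forall x y, halfline x -> halfline y ->
      k^-1 * `|x - y| - c <= `|f x - f y| <= k * `|x - y| + c &
    forall y, halfline y -> exists2 x, halfline x & `|f x - y| <= c].

Definition bounded_distance f g :=
  exists c : R, forall x, halfline x -> `|f x - g x| <= c.

Record qisom := QIsom {
  qisom_fun :> R -> R;
  qisomP : quasi_isometry qisom_fun }.

HB.instance Definition _ := gen_eqMixin qisom.
HB.instance Definition _ := gen_choiceMixin qisom.

Lemma halflineE (x : R) : halfline x = (0 <= x) :> Prop.
Proof. by rewrite /halfline /= in_itv /= andbT. Qed.

Definition qi_rel (f g : qisom) : bool := `[< bounded_distance f g >].

Lemma bounded_distance_refl f : bounded_distance f f.
Proof. by exists 0 => x _; rewrite subrr normr0. Qed.

Lemma bounded_distance_sym f g : bounded_distance f g -> bounded_distance g f.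
Proof. by move=> [c fg]; exists c => x x0; rewrite distrC fg. Qed.

Lemma bounded_distance_trans f g h :
  bounded_distance f g -> bounded_distance g h -> bounded_distance f h.
Proof.
move=> [c fg] [c' gh]; exists (c + c') => x x0.
by rewrite (le_trans (ler_distD (g x) _ _)) // lerD ?fg ?gh.
Qed.

Lemma qi_rel_refl : reflexive qi_rel.
Proof. by move=> f; apply/asboolP; exact: bounded_distance_refl. Qed.

Lemma qi_rel_sym : symmetric qi_rel.
Proof.
by move=> f g; apply/idP/idP => /asboolP fg; apply/asboolP;
  exact: bounded_distance_sym.
Qed.

Lemma qi_rel_trans : transitive qi_rel.
Proof.
move=> g f h /asboolP fg /asboolP gh; apply/asboolP.
exact: bounded_distance_trans gh.
Qed.

Canonical qi_equiv := EquivRel qi_rel qi_rel_refl qi_rel_sym qi_rel_trans.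

Definition QI := {eq_quot qi_equiv}.
HB.instance Definition _ := Choice.on QI.
HB.instance Definition _ := EqQuotient.on QI.

Definition qi_class (f : qisom) : QI := \pi_QI f.

Lemma qi_classP (f g : qisom) :
  qi_class f = qi_class g <-> bounded_distance f g.
Proof.
split; first by move/eqmodP/asboolP.
by move=> fg; apply/eqmodP/asboolP.
Qed.

Lemma qi_class_repr (q : QI) : qi_class (repr q) = q.
Proof. exact: reprK. Qed.

Lemma repr_qi_class (f : qisom) : bounded_distance (repr (qi_class f)) f.
Proof. by apply/qi_classP; rewrite qi_class_repr. Qed.

Lemma quasi_isometry_id : quasi_isometry id.
Proof.
split; first by [].
exists 1, 0; split=> //; first by move=> x y _ _; rewrite invr1 !mul1r; lra.
by move=> y y0; exists y; rewrite // subrr normr0.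
Qed.

Lemma quasi_isometry_comp f g :
  quasi_isometry f -> quasi_isometry g -> quasi_isometry (f \o g).
Proof.
move=> [fH [k [c [k1 c0 fB fS]]]] [gH [k' [c' [k'1 c'0 gB gS]]]].
have kp : 0 < k by lra.
have k'p : 0 < k' by lra.
split=> [x x0 /=|]; first exact/fH/gH.
exists (k * k'), (k * c' + c + c); split.
- by nra.
- by nra.
- move=> x y x0 y0 /=.
  have /andP[f1 f2] := fB _ _ (gH _ x0) (gH _ y0).
  have /andP[g1 g2] := gB _ _ x0 y0.
  apply/andP; split; last first.
    have : k * `|g x - g y| <= k * (k' * `|x - y| + c').
      by rewrite ler_wpM2l // ltW.
    rewrite mulrDr mulrA; lra.
  have : k^-1 * (k'^-1 * `|x - y| - c') <= k^-1 * `|g x - g y|.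
    by rewrite ler_wpM2l // invr_ge0 ltW.
  have : k^-1 * c' <= k * c'.
    by rewrite ler_wpM2r// (le_trans _ k1)// invf_le1.
  rewrite mulrBr mulrA -invfM; lra.
- move=> z z0; have [y y0 yz] := fS z z0; have [x x0 xy] := gS y y0.
  exists x => //=; rewrite (le_trans (ler_distD (f y) _ _))// lerD//.
  have /andP[_ f2] := fB _ _ (gH _ x0) y0.
  by rewrite (le_trans f2)// lerD2r ler_wpM2l // ltW.
Qed.

Lemma quasi_inverse f : quasi_isometry f -> exists g, [/\ quasi_isometry g,
  bounded_distance (f \o g) id & bounded_distance (g \o f) id].
Proof.
move=> [fH [k [c [k1 c0 fB fS]]]].
have kp : 0 < k by lra.
have /choice[g gP] : forall y, exists z, halfline y ->
    halfline z /\ `|f z - y| <= c.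
  move=> y; have [y0|y0] := pselect (halfline y); last by exists 0.
  by have [x x0 xy] := fS y y0; exists x.
have gH y : halfline y -> halfline (g y) by move=> /gP[].
have fg y : halfline y -> `|f (g y) - y| <= c by move=> /gP[].
have gf x : halfline x -> `|g (f x) - x| <= 3 * c * k.
  move=> x0; have /andP[f1 _] := fB _ _ (gH _ (fH _ x0)) x0.
  have f2 := fg _ (fH _ x0).
  have : k^-1 * `|g (f x) - x| <= 2 * c by lra.
  by rewrite mulrC ler_pdivrMr//; nra.
exists g; split; [|by exists c|by exists (3 * c * k)].
split=> //; exists k, (3 * c * k); split => //; first by nra.
- move=> x y x0 y0.
  have /andP[f1 f2] := fB _ _ (gH _ x0) (gH _ y0).
  have xg := fg _ x0; have yg := fg _ y0.
  have h1 : `|f (g x) - f (g y)| <= `|x - y| + 2 * c.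
    rewrite (le_trans (ler_distD x _ _))//.
    by have := ler_distD y x (f (g y)); rewrite (distrC y (f _)); lra.
  have h2 : `|x - y| <= `|f (g x) - f (g y)| + 2 * c.
    rewrite (le_trans (ler_distD (f (g x)) _ _))//.
    have := ler_distD (f (g y)) (f (g x)) y.
    by rewrite (distrC x (f _)); lra.
  apply/andP; split.
    rewrite lerBlDr mulrC ler_pdivrMr// mulrDl.
    have ck : c <= c * k by nra.
    have ckk : c * k <= c * k * k by rewrite ler_peMr// mulr_ge0// ltW.
    lra.
  have : k^-1 * `|g x - g y| <= `|x - y| + 3 * c by lra.
  by rewrite mulrC ler_pdivrMr//; lra.
- move=> x x0; exists (f x); [exact: fH|exact: gf].
Qed.

Lemma bounded_distance_compl (f g g' : qisom) :
  bounded_distance g g' -> bounded_distance (f \o g) (f \o g').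
Proof.
case: f g g' => f [fH [k [c [k1 c0 fB fS]]]] [g [gH ?]] [g' [g'H ?]] /=.
move=> [d gg']; exists (k * d + c) => x x0 /=.
have /andP[_ f2] := fB _ _ (gH _ x0) (g'H _ x0).
rewrite (le_trans f2)// lerD2r ler_wpM2l//; first lra.
exact: gg'.
Qed.

Lemma bounded_distance_compr (f f' g : qisom) :
  bounded_distance f f' -> bounded_distance (f \o g) (f' \o g).
Proof.
case: f f' g => f fP [f' f'P] [g [gH ?]] /= [d ff'].
by exists d => x x0; exact/ff'/gH.
Qed.

Definition qisom_id : qisom := QIsom quasi_isometry_id.

Definition qisom_comp (f g : qisom) : qisom :=
  QIsom (quasi_isometry_comp (qisomP f) (qisomP g)).

Definition qisom_inv (f : qisom) : qisom :=
  let: exist _ gP := cid (quasi_inverse (qisomP f)) in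
  let: And3 gq _ _ := gP in QIsom gq.

Lemma qisom_invP (f : qisom) :
  bounded_distance (f \o qisom_inv f) id /\
  bounded_distance (qisom_inv f \o f) id.
Proof. by rewrite /qisom_inv; case: cid => g []. Qed.

Definition qi_one : QI := qi_class qisom_id.
Definition qi_mul (p q : QI) : QI := qi_class (qisom_comp (repr p) (repr q)).
Definition qi_inv (p : QI) : QI := qi_class (qisom_inv (repr p)).

Lemma qi_mulE (f g : qisom) :
  qi_mul (qi_class f) (qi_class g) = qi_class (qisom_comp f g).
Proof.
apply/qi_classP.
apply: (@bounded_distance_trans _ (repr (qi_class f) \o g)).
  exact/bounded_distance_compl/repr_qi_class.
exact/bounded_distance_compr/repr_qi_class.
Qed.

Lemma qi_mulA : associative qi_mul.
Proof.
move=> p q r; rewrite -(qi_class_repr p) -(qi_class_repr q) -(qi_class_repr r).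
by rewrite !qi_mulE; apply/qi_classP; exact: bounded_distance_refl.
Qed.

Lemma qi_mul1 : left_id qi_one qi_mul.
Proof.
move=> p; rewrite -(qi_class_repr p) qi_mulE.
by apply/qi_classP; exact: bounded_distance_refl.
Qed.

Lemma qi_mulr1 : right_id qi_one qi_mul.
Proof.
move=> p; rewrite -(qi_class_repr p) qi_mulE.
by apply/qi_classP; exact: bounded_distance_refl.
Qed.

Lemma qi_mulV : left_inverse qi_one qi_inv qi_mul.
Proof.
move=> p; rewrite -{2}(qi_class_repr p) qi_mulE.
by apply/qi_classP; have [] := qisom_invP (repr p).
Qed.

Lemma qi_mulrV : right_inverse qi_one qi_inv qi_mul.
Proof.
move=> p; rewrite -{1}(qi_class_repr p) qi_mulE.
by apply/qi_classP; have [] := qisom_invP (repr p).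
Qed.

HB.instance Definition _ :=
  isGroup.Build QI qi_mulA qi_mul1 qi_mulr1 qi_mulV qi_mulrV.

Lemma qi_classM (f g : qisom) :
  (qi_class f * qi_class g)%g = qi_class (qisom_comp f g).
Proof. exact: qi_mulE. Qed.

Lemma cvg_ratio_bounded_distance (T : Type) (F : set_system T)
    {FF : Filter F} (f g : R -> R) (u : T -> R) (l : R) :
  bounded_distance f g -> u @ F --> +oo ->
  (fun t => f (u t) / u t) @ F --> l -> (fun t => g (u t) / u t) @ F --> l.
Proof.
move=> [c fg] uoo fl; apply/cvgrPdist_lt => e e0.
have c0 : 0 <= c by rewrite (le_trans _ (fg 0 _))// halflineE.
have e2 : 0 < e / 2 by lra.
near=> t.
have ut : c / (e / 2) < u t by near: t; move/cvgryPgt : uoo; exact.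
have u0 : 0 < u t by rewrite (le_lt_trans _ ut)// divr_ge0// ltW.
have ft : `|l - f (u t) / u t| < e / 2.
  by near: t; move/cvgrPdist_lt : fl; exact.
have gt : `|f (u t) / u t - g (u t) / u t| < e / 2.
  rewrite -mulrBl normrM [X in _ * X]gtr0_norm ?invr_gt0// ltr_pdivrMr//.
  rewrite (le_lt_trans (fg _ _))//; first by rewrite halflineE ltW.
  by rewrite mulrC -ltr_pdivrMr.
have := ler_distD (f (u t) / u t) l (g (u t) / u t); lra.
Unshelve. all: by end_near. Qed.

Definition limit_ratios (g : R -> R) : set R :=
  [set l | exists u : nat -> R,
    u @ \oo --> +oo /\ (fun n => g (u n) / u n) @ \oo --> l].

Definition ratio_cvg1 (g : R -> R) := g x / x @[x --> +oo] --> (1 : R).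

(* Both [limit_ratios] and [ratio_cvg1] are invariant under bounded distance,
   see [qi_S_class] and [qi_H_class], so the representative is irrelevant. *)
Definition qi_S (q : QI) : set R := limit_ratios (repr q).

Lemma qi_S_class (g : qisom) : qi_S (qi_class g) = limit_ratios g.
Proof.
have gg := repr_qi_class g; have gg' := bounded_distance_sym gg.
by apply/seteqP; split => l [u [uoo ul]]; exists u; split => //;
  exact: cvg_ratio_bounded_distance uoo ul.
Qed.

Definition qi_H_1M (M : R) : set QI := [set q | qi_S q = `[1, M]%classic].

Definition qi_H_1oo : set QI := \bigcup_(M in [set M : R | 1 < M]) qi_H_1M M.

Definition qi_H : set QI := [set q : QI | ratio_cvg1 (repr q)].

Lemma qi_H_class (g : qisom) : qi_H (qi_class g) <-> ratio_cvg1 g.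
Proof.
have gg := repr_qi_class g; have gg' := bounded_distance_sym gg.
by split; apply: (cvg_ratio_bounded_distance (u := id)).
Qed.

End QuasiIsometries.

Section PiecewiseLinear.
Variable R : realType.
Implicit Types f : R -> R.

Definition halfline_homeo f := exists g : R -> R,
  [/\ set_fun halfline halfline f, set_fun halfline halfline g,
      {within halfline, continuous f}, {within halfline, continuous g} &
      forall x, halfline x -> g (f x) = x /\ f (g x) = x].

Definition slope_on f (A : set R) (l : R) :=
  forall s t, A s -> A t -> f t - f s = l * (t - s).

(* Near each point, [f] is affine on either side of it; in particular only
   finitely many affine pieces meet a bounded part of the half-line. *)
Definition piecewise_linear f := forall x, halfline x ->
  exists e : R, [/\ 0 < e, exists l, slope_on f `[x, x + e] l &
    exists l, slope_on f (`[x - e, x] `&` halfline) l].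

(* The end point 0 is not counted as a break point. *)
Definition break_points f : set R :=
  [set x | 0 < x /\ ~ derivable f x 1].

(* The slopes of [f] are its derivatives at the points where it is
   differentiable. *)
Definition bounded_slopes f :=
  break_points f `<=` isolated (break_points f) /\
  exists2 C : R, 1 < C &
    forall x, 0 < x -> derivable f x 1 -> C^-1 < 'D_1 f x < C.

Definition pl_homeo f :=
  [/\ halfline_homeo f, piecewise_linear f & bounded_slopes f].

Lemma halfline_chain (P : R -> R -> Prop) :
  (forall x, P x x) ->
  (forall x y z, x <= y <= z -> P x y -> P y z -> P x z) ->
  (forall x, 0 <= x -> exists2 e, 0 < e &
     (forall y, x <= y <= x + e -> P x y) /\
     (forall y, 0 <= y -> x - e <= y <= x -> P y x)) ->
  forall u v, 0 <= u -> u <= v -> P u v.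
Proof.
move=> Pxx Ptr Ploc u v u0 uv.
pose S := [set t | u <= t <= v /\ P u t].
have Su : S u by split => //; rewrite lexx.
have Sub : ubound S v by move=> t [/andP[]].
have S_sup : has_sup S by split; [exists u | exists v].
have us : u <= sup S by apply: ub_le_sup => //; exists v.
have sv : sup S <= v by apply: ge_sup => //; exists u.
have [e e0 [Pr Pl]] := Ploc (sup S) (le_trans u0 us).
have Pus : P u (sup S).
  have [t [/andP[ut tv] Put] ts] := sup_adherent e0 S_sup.
  have tsup : t <= sup S.
    by apply: ub_le_sup; [exists v | split => //; rewrite ut].
  apply: Ptr Put _; first by rewrite ut.
  by apply: Pl; [exact: le_trans ut | rewrite (ltW ts)].
have [vs|sv'] := leP v (sup S).
  by have -> : v = sup S by apply/le_anti; rewrite vs.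
pose w := Num.min v (sup S + e).
have sw : sup S < w by rewrite lt_min sv' ltrDl.
have : S w.
  split; first by rewrite ge_min lexx andbT (le_trans us (ltW sw)).
  apply: Ptr Pus _; first by rewrite us ltW.
  by apply: Pr; rewrite (ltW sw) ge_min lexx orbT.
by move=> /(ub_le_sup (ex_intro _ v Sub)); rewrite leNgt sw.
Qed.

Lemma slope_on_derive f (a b l : R) : a < b -> slope_on f `[a, b] l ->
  is_derive ((a + b) / 2) 1 f l.
Proof.
move=> ab fl; set m := (a + b) / 2.
have am : m \in `]a, b[ by rewrite in_itv /= /m; apply/andP; split; lra.
apply: (@near_eq_is_derive _ _ _ (fun x => f m + l * (x - m))).
  near=> x; rewrite -(fl m x) ?subrKC//=.
    by rewrite subset_itv_oo_cc.
  have : x \in `]a, b[ by near: x; exact: near_in_itvoo.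
  exact: subset_itv_oo_cc.
by apply: is_derive_eq; rewrite add0r mul1r subr0 scaler1.
Unshelve. all: by end_near. Qed.

Lemma pl_homeo_bilipschitz f : pl_homeo f -> exists2 C : R, 1 < C &
  forall x y, 0 <= x -> x <= y ->
    C^-1 * (y - x) <= f y - f x <= C * (y - x).
Proof.
move=> [_ fpl [_ [C C1 fC]]]; exists C => // x y.
have slopeC a b l : 0 <= a -> a < b -> slope_on f `[a, b] l -> C^-1 < l < C.
  move=> a0 ab fl; have [dl <-] := slope_on_derive ab fl.
  by apply: fC => //; lra.
have slopeP a b l : 0 <= a -> slope_on f `[a, b] l ->
    forall s t, a <= s -> s <= t -> t <= b ->
    C^-1 * (t - s) <= f t - f s <= C * (t - s).
  move=> a0 fl s t ast st tb.
  have [->|tns] := eqVneq t s; first by rewrite !subrr !mulr0 lexx.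
  have ab : a < b by have : s < t; rewrite ?lt_neqAle ?st 1?eq_sym ?tns//; lra.
  have /andP[l1 l2] := slopeC _ _ _ a0 ab fl.
  rewrite (fl s t); first by rewrite !ler_wpM2r ?subr_ge0// ltW.
  - by rewrite /= in_itv /= ast; lra.
  - by rewrite /= in_itv /= tb; lra.
move: x y; apply: halfline_chain.
- by move=> x; rewrite !subrr !mulr0 lexx.
- move=> x y z _ /andP[? ?] /andP[? ?]; apply/andP; split; lra.
- move=> x x0; have [|e [e0 [l fl] [l' fl']]] := fpl x.
    by rewrite halflineE.
  exists e => //; split => y.
    by move=> /andP[xy ye]; exact: slopeP fl _ _ _ _ _.
  move=> y0 /andP[ey yx]; apply: (slopeP y x l') => // s t.
  rewrite /= !in_itv /= => /andP[ys sx] /andP[yt tx].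
  by apply: fl'; split; rewrite ?halflineE /= ?in_itv /=; lra.
Qed.

Lemma pl_homeo_quasi_isometry f : pl_homeo f -> quasi_isometry f.
Proof.
move=> fpl; have [C C1 fC] := pl_homeo_bilipschitz fpl.
have [[g [fH gH _ _ fg]] _ _] := fpl.
split=> //; exists C, 0; split => //; first exact: ltW.
- suff main x y : 0 <= x -> x <= y ->
      C^-1 * `|x - y| - 0 <= `|f x - f y| <= C * `|x - y| + 0.
    move=> x y; rewrite !halflineE => x0 y0.
    have [xy|yx] := leP x y; first exact: main.
    by rewrite (distrC x) (distrC (f x)); apply: main => //; exact: ltW.
  move=> x0 xy; have /andP[f1 f2] := fC _ _ x0 xy.
  have fxy : 0 <= f y - f x.
    by rewrite (le_trans _ f1)// mulr_ge0 ?subr_ge0// invr_ge0; lra.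
  rewrite (distrC x) (distrC (f x)) (ger0_norm fxy) ger0_norm ?subr_ge0//.
  by rewrite subr0 addr0 f1.
- move=> y y0; exists (g y); first exact: gH.
  by have [_ ->] := fg _ y0; rewrite subrr normr0.
Qed.

Definition pl_class f (fpl : pl_homeo f) : QI R :=
  qi_class (QIsom (pl_homeo_quasi_isometry fpl)).

End PiecewiseLinear.

(* Main.v *)
Require Import Defs.
From mathcomp Require Import all_boot all_order all_algebra.
From mathcomp Require Import all_classical all_reals all_analysis.
From mathcomp Require Import ring lra.

Set Implicit Arguments.
Unset Strict Implicit.
Unset Printing Implicit Defensive.

Import Order.TTheory GRing.Theory Num.Theory.

Local Open Scope classical_set_scope.
Local Open Scope ring_scope.

(** Composing with an element of [qi_H] changes a quasi-isometry only by [o(x)],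
    and asymptotic equality up to [o(x)] is compatible with composition on both
    sides.  So if the two products commuted in [QI], then [f (g y) - g (f y)] would
    be [o(y)] ([commute_asymp]).

    On [[a n, a n.+1]] the graphs of [f] and [g] are bumps over the same base
    with the same break point [x n].  Since all limit ratios of [f] and [g] are
    at least 1, the bumps point upwards for [n] large: [lam n] and [lam' n]
    exceed [1 + eps] ([bump_slope_gt1]).  Two such bumps of different slopes do
    not commute, quantitatively: the steeper map and the flatter one, applied in
    both orders at the point sent to [x n] by the flatter one, give values that
    differ by at least a fixed multiple of [x n - a n] ([bump_commutator]).  The
    ratio [x n / a n] being at least [K], this is at least a fixed proportion
    of the test point, which lies in [(a n, x n)] and so tends to infinity. *)

(** * Affine pieces and the commutator of two bumps *)

Section Affine.
Variable R : realType.
Implicit Types f g : R -> R.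

Lemma slope_on_subset f (A B : set R) l :
  A `<=` B -> slope_on f B l -> slope_on f A l.
Proof. by move=> AB fB s t /AB As /AB At; exact: fB. Qed.

(** The difference quotients of [f] at [y] are constantly [l] on the left and
    constantly [m] on the right, and differentiability forces both one-sided
    limits to coincide. *)
Lemma slope_on_derivable_eq f (p y q l m : R) : p < y -> y < q ->
  derivable f y 1 -> slope_on f `[p, y] l -> slope_on f `[y, q] m -> l = m.
Proof.
move=> py yq /cvg_ex[d /cvgrPdist_lt fd] fl fm.
have near_d e : 0 < e -> `|d - l| < e /\ `|d - m| < e.
  move=> /fd /nbhs_ballP[r /= r0 rfd].
  pose s := Num.min (r / 2) (Num.min (y - p) (q - y)).
  have s0 : 0 < s by rewrite !lt_min; apply/and3P; split; lra.
  have [sr sp sq] : [/\ s < r, s <= y - p & s <= q - y].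
    by split; rewrite /s ?gt_min ?ge_min ?lexx ?orbT //; apply/orP; left; lra.
  split.
  - have := rfd (- s); rewrite /ball /= sub0r opprK gtr0_norm //.
    rewrite oppr_eq0 gt_eqF // => /(_ sr isT).
    rewrite /GRing.scale /= mulr1.
    rewrite (fl y (- s + y)) /=; first last.
    + by rewrite in_itv /=; lra.
    + by rewrite in_itv /=; lra.
    rewrite addrK mulrCA mulVf ?mulr1 //.
    by rewrite oppr_eq0 gt_eqF.
  - have := rfd s; rewrite /ball /= sub0r normrN gtr0_norm //.
    rewrite gt_eqF // => /(_ sr isT).
    rewrite /GRing.scale /= mulr1.
    rewrite (fm y (s + y)) /=; first last.
    + by rewrite in_itv /=; lra.
    + by rewrite in_itv /=; lra.
    rewrite addrK mulrCA mulVf ?mulr1 //.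
    by rewrite gt_eqF.
apply/eqP; rewrite -subr_eq0 -normr_le0 leNgt; apply/negP => lm.
have [|dl dm] := near_d (`|l - m| / 2); first lra.
by have := ler_distD d l m; rewrite (distrC l d); lra.
Qed.

(** Affine pieces can be glued at any point where [f] is differentiable, so
    being affine propagates along [[a, b]] from the local pieces by
    [halfline_chain]. *)
Lemma piecewise_linear_affine f (a b : R) : 0 <= a -> a <= b ->
  piecewise_linear f -> (forall y, a < y < b -> derivable f y 1) ->
  exists l, slope_on f `[a, b] l.
Proof.
move=> a0 ab fpl fd.
(* Cutting with [[a, b]] makes the property trivial outside of [[a, b]], where
   nothing is known on the differentiability of [f]. *)
pose P u v := exists l, slope_on f (`[u, v] `&` `[a, b]) l.
suff [l fl] : P a b by exists l; move: fl; rewrite setIid.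
apply: halfline_chain (a0) (ab).
- move=> y; exists 0 => s t [/= + _] [/= + _].
  rewrite !in_itv /= => ys yt.
  have -> : s = y by lra.
  have -> : t = y by lra.
  lra.
- move=> u y v /andP[uy yv] [l fl] [m fm].
  have [ya|ay] := leP y a.
    exists m; apply: slope_on_subset fm => s /=; rewrite !in_itv /=; lra.
  have [by_|yb] := leP b y.
    exists l; apply: slope_on_subset fl => s /=; rewrite !in_itv /=; lra.
  have [uEy|uNy] := eqVneq u y; first by exists m; rewrite uEy.
  have [yEv|yNv] := eqVneq y v; first by exists l; rewrite -yEv.
  have {uNy}uy' : u < y by rewrite lt_neqAle uNy.
  have {yNv}yv' : y < v by rewrite lt_neqAle yNv.
  have lm : l = m.
    apply: (@slope_on_derivable_eq f (Num.max u a) y (Num.min v b)).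
    - by rewrite gt_max uy'.
    - by rewrite lt_min yv'.
    - by apply: fd; rewrite ay.
    - apply: slope_on_subset fl => s /=.
      by rewrite !in_itv /= ge_max => /andP[/andP[]]; lra.
    - apply: slope_on_subset fm => s /=.
      by rewrite !in_itv /= le_min => /and3P[]; lra.
  subst m; exists l => s t [/= + +] [/= + +].
  have low s' : u <= s' <= y -> a <= s' <= b -> f y - f s' = l * (y - s').
    by move=> ? ?; apply: fl; split => /=; rewrite in_itv /=; lra.
  have high s' : y <= s' <= v -> a <= s' <= b -> f y - f s' = l * (y - s').
    by move=> ? ?; apply: fm; split => /=; rewrite in_itv /=; lra.
  have both s' : u <= s' <= v -> a <= s' <= b -> f y - f s' = l * (y - s').
    move=> /andP[us sv] sab; have [sy|ys] := leP s' y.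
      by apply: low => //; rewrite us.
    by apply: high => //; rewrite sv ltW.
  rewrite !in_itv /= => us sa ut ta.
  by have := both _ us sa; have := both _ ut ta; lra.
- move=> y y0; have [|e [e0 [l fl] [m fm]]] := fpl y.
    by rewrite halflineE.
  exists e => //; split => z.
  + move=> yz; exists l; apply: slope_on_subset fl => s [/= + _].
    by rewrite !in_itv /=; lra.
  + move=> z0 yz; exists m; apply: slope_on_subset fm => s [/= + _].
    rewrite in_itv /= => zs; split; last by rewrite halflineE; lra.
    by rewrite /= in_itv /=; lra.
Qed.

Lemma break_point_affine f (a x b : R) : 0 <= a -> a < x < b ->
  piecewise_linear f -> break_points f `&` `]a, b[ = [set x] ->
  exists l, slope_on f `[x, b] l.
Proof.
move=> a0 axb fpl fbr.
apply: piecewise_linear_affine => // [||y xyb]; [lra..|].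
apply: contrapT => ndy; have : (break_points f `&` `]a, b[) y.
  by split; [split => //; lra | rewrite /= in_itv /=; lra].
by rewrite fbr => yx; move: xyb; rewrite yx ltxx.
Qed.

(** Take for [y] the point that the flatter map [g] sends to the break point
    [x].  The steeper map [f] has then already crossed [x], so that [g] acts on
    [f y] by its second slope [m], and
    [[
    f (g y) - g (f y) = (lam - lam') * (1 - m / lam') * (x - a).
    ]]
    Since [g] lies above the diagonal at [x] and returns to it at [b], its
    second slope satisfies [m < 1], and hence
    [1 - m / lam' >= eps / (1 + eps)]. *)
Lemma bump_commutator f g (a x b lam lam' eps : R) :
  0 < eps -> 0 <= a -> a < x < b ->
  pl_homeo f -> piecewise_linear g ->
  f a = a -> f b = b -> g a = a -> g b = b ->
  slope_on f `[a, x] lam -> slope_on g `[a, x] lam' ->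
  break_points g `&` `]a, b[ = [set x] ->
  1 + eps < lam' -> lam' + eps < lam ->
  exists2 y, a < y < x &
    eps * (eps / (1 + eps)) * (x - a) <= f (g y) - g (f y).
Proof.
move=> e0 a0 axb fpl gpl fa fb ga gb fl gl gbr lam'1 lam'lam.
have [m gm] : exists m, slope_on g `[x, b] m.
  exact: break_point_affine gbr.
have [C C1 fC] := pl_homeo_bilipschitz fpl.
have fP z : a <= z <= x -> f z = a + lam * (z - a).
  by move=> zax; rewrite -(fl a z) ?fa /= ?in_itv /=; lra.
have gP z : a <= z <= x -> g z = a + lam' * (z - a).
  by move=> zax; rewrite -(gl a z) ?ga /= ?in_itv /=; lra.
have gxP : g x = a + lam' * (x - a) by apply: gP; lra.
have m1 : m < 1.
  have : g b - g x = m * (b - x) by apply: gm; rewrite /= in_itv /=; lra.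
  rewrite gb gxP => gbx; have : m * (b - x) < 1 * (b - x) by nra.
  by rewrite ltr_pM2r; lra.
pose L := (x - a) / lam'; pose y := a + L.
have lam'L : lam' * L = x - a by rewrite mulrC divfK // gt_eqF //; lra.
have L0 : 0 < L by apply: divr_gt0; lra.
have yaL : y - a = L by rewrite /y addrC addKr.
clearbody y; clearbody L.
have axy : a < y < x by nra.
have gy : g y = x by rewrite gP ?yaL ?lam'L; lra.
have fyE : f y = a + lam * L by rewrite fP ?yaL //; lra.
have xfy : x <= f y by rewrite fyE; nra.
have fyb : f y <= b.
  have /andP[+ _] : C^-1 * (b - y) <= f b - f y <= C * (b - y).
    by apply: fC; lra.
  rewrite fb -[f y <= b]subr_ge0; apply: le_trans.
  by apply: mulr_ge0; [rewrite invr_ge0|]; lra.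
have gfy : g (f y) = g x + m * (f y - x).
  by rewrite -(gm x (f y)) ?/= ?in_itv /=; lra.
have fx : f x = a + lam * (x - a) by apply: fP; lra.
exists y => //; rewrite gy gfy gxP fx fyE.
have -> : a + lam * (x - a) - (a + lam' * (x - a) + m * (a + lam * L - x)) =
  (lam - lam') * ((lam' - m) * L).
  have xE : x = a + lam' * L by lra.
  by rewrite -lam'L {1}xE; ring.
rewrite -lam'L -mulrA; apply: ler_pM; [lra | | lra |].
- by apply: mulr_ge0; [apply: divr_ge0|nra]; lra.
- rewrite mulrA ler_pM2r // mulrAC ler_pdivrMr; last lra.
  nra.
Qed.

End Affine.

(** * Asymptotic equality and quasi-isometries *)

Section Asymptotic.
Variable R : realType.
Implicit Types (p q r : R -> R) (f g : qisom R) (h : QI R).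

Lemma ge0_halfline (y : R) : 0 <= y -> halfline y.
Proof. by rewrite halflineE. Qed.

(** [p x - q x = o(x)]: unlike [p x / q x --> 1], this form needs no information
    on the zeros of [q]. *)
Definition asymp p q :=
  forall e, 0 < e -> \forall x \near +oo, `|p x - q x| <= e * x.

Lemma asymp_sym p q : asymp p q -> asymp q p.
Proof. by move=> pq e /pq; apply: filterS => y; rewrite distrC. Qed.

Lemma asymp_trans p q r : asymp p q -> asymp q r -> asymp p r.
Proof.
move=> pq qr e e0; have e2 : 0 < e / 2 by lra.
near=> y; have : `|p y - q y| <= e / 2 * y by near: y; exact: pq.
have : `|q y - r y| <= e / 2 * y by near: y; exact: qr.
by have := ler_distD (q y) (p y) (r y); lra.
Unshelve. all: by end_near. Qed.

Lemma bounded_distance_asymp p q : bounded_distance p q -> asymp p q.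
Proof.
move=> [c pq] e e0; near=> y.
have y0 : 0 <= y by near: y; apply: nbhs_pinfty_ge; exact: num_real.
have cy : c / e <= y by near: y; apply: nbhs_pinfty_ge; exact: num_real.
rewrite (le_trans (pq y _)) ?halflineE //.
by rewrite mulrC -ler_pdivrMr.
Unshelve. all: by end_near. Qed.

Lemma qisom_linear_growth f :
  exists2 k, 0 < k & \forall x \near +oo, f x <= k * x.
Proof.
have [fH [k [c [k1 c0 fB _]]]] := qisomP f.
exists (k + 1); first lra.
near=> y; have y0 : 0 <= y by near: y; apply: nbhs_pinfty_ge; exact: num_real.
have cy : c + f 0 <= y by near: y; apply: nbhs_pinfty_ge; exact: num_real.
have /andP[_] := fB y 0 (ge0_halfline y0) (ge0_halfline (lexx 0)).
by rewrite subr0 (ger0_norm y0); have := ler_norm (f y - f 0); lra.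
Unshelve. all: by end_near. Qed.

Lemma qisom_cvgy f : f x @[x --> +oo] --> +oo.
Proof.
have [fH [k [c [k1 c0 fB _]]]] := qisomP f.
apply/cvgryPge => A; near=> y.
have y0 : 0 <= y by near: y; apply: nbhs_pinfty_ge; exact: num_real.
have cy : k * (A + c + f 0) <= y.
  by near: y; apply: nbhs_pinfty_ge; exact: num_real.
have f0 : 0 <= f 0 by rewrite -halflineE; apply: fH; rewrite halflineE.
have fy : 0 <= f y by rewrite -halflineE; apply: fH; rewrite halflineE.
have /andP[+ _] := fB y 0 (ge0_halfline y0) (ge0_halfline (lexx 0)).
have : `|f y - f 0| <= f y + f 0 by rewrite ler_norml; lra.
have : A + c + f 0 <= k^-1 * y by rewrite mulrC ler_pdivlMr ?(mulrC _ k); lra.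
by rewrite subr0 (ger0_norm y0); lra.
Unshelve. all: by end_near. Qed.

(** The multiplicative constant of [f] only rescales [e], and its additive
    constant is itself [o(x)]. *)
Lemma asymp_compl f p q : set_fun halfline halfline p ->
  set_fun halfline halfline q -> asymp p q -> asymp (f \o p) (f \o q).
Proof.
have [fH [k [c [k1 c0 fB _]]]] := qisomP f.
move=> pH qH pq e e0; have ek : 0 < e / 2 / k by apply: divr_gt0; lra.
near=> y => /=.
have y0 : 0 <= y by near: y; apply: nbhs_pinfty_ge; exact: num_real.
have cy : c / (e / 2) <= y by near: y; apply: nbhs_pinfty_ge; exact: num_real.
have pqy : `|p y - q y| <= e / 2 / k * y by near: y; exact: pq.
have /andP[_] :=
  fB _ _ (pH _ (ge0_halfline y0)) (qH _ (ge0_halfline y0)).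
have : k * `|p y - q y| <= e / 2 * y.
  rewrite mulrC -ler_pdivlMr; last lra.
  by apply: le_trans pqy _; rewrite mulrAC.
move: cy; rewrite ler_pdivrMr; lra.
Unshelve. all: by end_near. Qed.

(** As [f] grows linearly, [o(f x)] is [o(x)]. *)
Lemma asymp_compr f p q : asymp p q -> asymp (p \o f) (q \o f).
Proof.
have [k k0 fk] := qisom_linear_growth f.
move=> pq e e0; have ek : 0 < e / k by apply: divr_gt0.
have fpq := @qisom_cvgy f _ (pq _ ek).
near=> y => /=.
have fky : f y <= k * y by near: y.
have : `|p (f y) - q (f y)| <= e / k * f y.
  by near: y; exact: fpq.
move/le_trans; apply.
have -> : e * y = e / k * (k * y) by rewrite mulrA divfK // gt_eqF.
by rewrite ler_pM2l.
Unshelve. all: by end_near. Qed.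

Lemma qi_H_asymp h : qi_H h -> asymp (repr h) id.
Proof.
move=> /cvgrPdist_le hl e /hl he; near=> y.
have y0 : 0 < y by near: y; apply: nbhs_pinfty_gt; exact: num_real.
have : `|1 - repr h y / y| <= e by near: y.
rewrite -(divff (lt0r_neq0 y0)) -mulrBl normrM.
rewrite (gtr0_norm (x := y^-1)) ?invr_gt0 //.
by rewrite ler_pdivrMr // distrC.
Unshelve. all: by end_near. Qed.

(** Elements of [qi_H] are asymptotic to the identity and [asymp] is a
    congruence for composition, so erasing them changes both products by
    [o(x)] only. *)
Lemma commute_asymp f g h h' : qi_H h -> qi_H h' ->
  commute (h * qi_class f)%g (h' * qi_class g)%g -> asymp (f \o g) (g \o f).
Proof.
move=> hH h'H.
(* One side of the commutation; it is used again with [f], [g] exchanged. *)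
have main (h1 h2 : QI R) f1 f2 : qi_H h1 -> qi_H h2 ->
    asymp (repr h1 \o f1 \o (repr h2 \o f2)) (f1 \o f2).
  move=> h1H h2H.
  apply: (@asymp_trans _ (f1 \o (repr h2 \o f2))).
    exact: (asymp_compr (qisom_comp f1 (qisom_comp (repr h2) f2))
      (qi_H_asymp h1H)).
  apply: asymp_compl.
  - by have [] := qisomP (qisom_comp (repr h2) f2).
  - by have [] := qisomP f2.
  - exact: (asymp_compr f2 (qi_H_asymp h2H)).
rewrite /commute -(qi_class_repr h) -(qi_class_repr h') !qi_classM.
move=> /qi_classP /bounded_distance_asymp comm.
apply: asymp_trans (asymp_sym (main _ _ f g hH h'H)) _.
exact: asymp_trans comm (main _ _ g f h'H hH).
Qed.

(** Otherwise [r u / u <= l] for arbitrarily large [u]; these ratios are bounded,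
    so by Bolzano-Weierstrass they accumulate at some element of
    [limit_ratios r] that is at most [l]. *)
Lemma limit_ratios_ge_near r (l0 : R) : (\forall x \near +oo, 0 <= r x) ->
  (forall l, limit_ratios r l -> l0 <= l) ->
  forall l, l < l0 -> \forall x \near +oo, l < r x / x.
Proof.
move=> r0 rl0 l ll0; apply: contrapT => nearl.
have u_ex (n : nat) : exists x : R,
    [/\ n%:R <= x, 0 < x, 0 <= r x & r x / x <= l].
  have n_le := nbhs_pinfty_ge (num_real (n%:R : R)).
  have gt0 := nbhs_pinfty_gt (num_real (0 : R)).
  apply: contrapT => nex; apply: nearl.
  apply: filterS3 n_le gt0 r0 => y ny y0 ry.
  by rewrite ltNge; apply/negP => ryl; apply: nex; exists y.
have /choice[u uP] := u_ex.
have ru0 n : 0 <= r (u n) / u n.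
  by have [_ /ltW ? ? _] := uP n; apply: divr_ge0.
have rul n : r (u n) / u n <= l by have [] := uP n.
have bdd : bounded_fun (fun n => r (u n) / u n).
  exists l; split; first exact: num_real.
  move=> m lm n _ /=; rewrite ger0_norm //.
  exact: le_trans (rul n) (ltW lm).
have [s s_incr sl'] := bolzano_weierstrass bdd.
set l' := limn _ in sl'.
suff : l0 <= l'.
  have : l' <= l by apply: cvgr_to_le sl' _; apply: nearW => n /=; exact: rul.
  lra.
apply: rl0; exists (u \o s); split => //.
apply: (@ger_cvgy _ _ _ _ (fun n => n%:R)); last exact: cvgr_idn.
apply: nearW => n /=; have [+ _ _ _] := uP (s n).
apply: le_trans; rewrite ler_nat.
elim: n => // n; move/leq_ltn_trans; apply.
by have := s_incr n.+1 n; rewrite leEnat ltnn ltnNge => ->.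
Qed.

End Asymptotic.

(** * Slopes at infinity *)

Section Slopes.
Variable R : realType.

Lemma geometric_gap_cvgy (a : nat -> R) (K : R) : 1 < K ->
  (forall n, 0 < a n) -> (forall n, K * a n <= a n.+1) -> a @ \oo --> +oo.
Proof.
move=> K1 a0 aK.
have aN n : a 0%N + n%:R * ((K - 1) * a 0%N) <= a n /\ a 0%N <= a n.
  elim: n => [|n [IH1 IH2]]; first by rewrite mul0r addr0.
  have := aK n; have := a0 0%N; rewrite -natr1 mulrDl mul1r.
  have : (K - 1) * a 0%N <= (K - 1) * a n by rewrite ler_pM2l; lra.
  have : 0 <= (K - 1) * a 0%N by apply: mulr_ge0; [lra | exact: ltW].
  by move=> ? ? ? ?; split; lra.
have c0 : 0 < (K - 1) * a 0%N by apply: mulr_gt0; [lra | exact: a0].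
apply/cvgryPge => A.
have /cvgryPge/(_ (A / ((K - 1) * a 0%N))) := @cvgr_idn R.
apply: filterS => n; rewrite ler_pdivrMr // => An.
by have [+ _] := aN n; have := a0 0%N; lra.
Qed.

(** If [lam n < 1 - eps], then the ratio [f (x n) / x n] is at most
    [1 - eps * (1 - K^-1)], because [x n - a n] is at least the fraction
    [1 - K^-1] of [x n].  Since [a] tends to infinity, this cannot happen for
    large [n]: all limit ratios of [f] are at least 1. *)
Lemma bump_slope_gt1 (f : R -> R) (f_pl : pl_homeo f) (a x lam : nat -> R)
    (eps K : R) : qi_H_1oo (pl_class f_pl) -> 0 < eps -> 1 < K ->
  (forall n, 0 < a n) -> a @ \oo --> +oo -> (forall n, f (a n) = a n) ->
  (forall n, K * a n < x n) ->
  (forall n, slope_on f `[a n, x n] (lam n)) ->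
  (forall n, eps < `|lam n - 1|) ->
  \forall n \near \oo, 1 + eps < lam n.
Proof.
move=> [M _]; rewrite /qi_H_1M /= /pl_class qi_S_class /= => fM.
move=> eps0 K1 a0 acvg fa xK fl lam_far.
have ax n : a n < x n by have := xK n; have := a0 n; nra.
have fH : set_fun halfline halfline f by have [[? []]] := f_pl.
have xcvg : x @ \oo --> +oo.
  by apply: ger_cvgy acvg; apply: nearW => n; exact: ltW.
pose c := eps * (1 - K^-1).
have c0 : 0 < c.
  by apply: mulr_gt0 => //; rewrite subr_gt0 invf_lt1 //; lra.
have frat : \forall y \near +oo, 1 - c < f y / y.
  apply: (@limit_ratios_ge_near _ f 1).
  - near=> y; rewrite -halflineE; apply: fH; rewrite halflineE.
    by near: y; apply: nbhs_pinfty_ge; exact: num_real.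
  - by move=> l; rewrite fM /= in_itv /= => /andP[].
  - lra.
near=> n; have : 1 - c < f (x n) / x n by near: n; exact: (xcvg _ frat).
have := lam_far n; have [lam1|lam1] := leP 1 (lam n).
  by rewrite ger0_norm; lra.
rewrite ltr0_norm; last lra.
move=> eps_lam; have x0 : 0 < x n by have := ax n; have := a0 n; lra.
have fx : f (x n) - f (a n) = lam n * (x n - a n).
  by apply: fl; rewrite /= in_itv /= lexx ltW.
rewrite ltr_pdivlMr // => low; exfalso.
have : a n < K^-1 * x n.
  by rewrite mulrC ltr_pdivlMr ?(mulrC _ K); [exact: xK | lra].
move=> aK; have : eps * (x n - a n) < (1 - lam n) * (x n - a n).
  by rewrite ltr_pM2r; have := ax n; lra.
have : eps * (x n - K^-1 * x n) < eps * (x n - a n) by rewrite ltr_pM2l; lra.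
by move: low fx; rewrite fa /c; lra.
Unshelve. all: by end_near. Qed.

End Slopes.

(** * Non-commutation *)

Theorem theorem5p4 (R : realType) (f g : R -> R)
    (f_pl : pl_homeo f) (g_pl : pl_homeo g)
    (f_H : qi_H_1oo (pl_class f_pl)) (g_H : qi_H_1oo (pl_class g_pl))
    (a x lam lam' : nat -> R) (eps K K' : R)
    (a_gt0 : forall n, 0 < a n)
    (a_incr : forall m n, (m < n)%N -> a m < a n)
    (f_fix : forall n, f (a n) = a n) (g_fix : forall n, g (a n) = a n)
    (x_in : forall n, a n < x n < a n.+1)
    (f_break : forall n, break_points f `&` `]a n, a n.+1[ = [set x n])
    (g_break : forall n, break_points g `&` `]a n, a n.+1[ = [set x n])
    (f_slope : forall n, slope_on f `[a n, x n] (lam n))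
    (g_slope : forall n, slope_on g `[a n, x n] (lam' n))
    (eps_gt0 : 0 < eps) (K_gt1 : 1 < K) (K'_gt1 : 1 < K')
    (lam_far : forall n, eps < `|lam n - 1|)
    (lam'_far : forall n, eps < `|lam' n - 1|)
    (lam_lam'_far : forall n, eps < `|lam n - lam' n|)
    (x_ratio : forall n, K < x n / a n < K')
    (a_ratio : forall n, K < a n.+1 / x n < K')
    (h h' : QI R) (hH : qi_H h) (h'H : qi_H h') :
  ~ commute (h * pl_class f_pl)%g (h' * pl_class g_pl)%g.
Proof.
move=> /(commute_asymp hH h'H) /= fg_gf.
have xK n : K * a n < x n by have /andP[+ _] := x_ratio n; rewrite ltr_pdivlMr.
have a_cvg : a @ \oo --> +oo.
  apply: (geometric_gap_cvgy K_gt1) => // n.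
  by have /andP[_ /ltW] := x_in n; apply: le_trans; exact/ltW/xK.
have lam_gt :=
  bump_slope_gt1 f_H eps_gt0 K_gt1 a_gt0 a_cvg f_fix xK f_slope lam_far.
have lam'_gt :=
  bump_slope_gt1 g_H eps_gt0 K_gt1 a_gt0 a_cvg g_fix xK g_slope lam'_far.
(* [d] is the constant of [bump_commutator]; as [x n - a n > (1 - K^-1) * y] for
   [y < x n], the tolerance [d * (1 - K^-1)] is contradicted at large [y]. *)
pose d := eps * (eps / (1 + eps)).
have d0 : 0 < d by apply: mulr_gt0 => //; apply: divr_gt0; lra.
have c0 : 0 < 1 - K^-1 by rewrite subr_gt0 invf_lt1 //; lra.
have [A [_ small]] := fg_gf (d * (1 - K^-1)) (mulr_gt0 d0 c0).
have [n [lam_n lam'_n An]] :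
    exists n, [/\ 1 + eps < lam n, 1 + eps < lam' n & A < a n].
  suff /filter_ex[n ?] : \forall n \near \oo,
    [/\ 1 + eps < lam n, 1 + eps < lam' n & A < a n] by exists n.
  near=> n; split; near: n => //.
  by move/cvgryPgt : a_cvg; exact.
have [y /andP[ay yx]] : exists2 y, a n < y < x n &
    d * (x n - a n) <= `|f (g y) - g (f y)|.
  have [[_ f_lin _] [_ g_lin _]] := (f_pl, g_pl).
  have far := lam_lam'_far n; have an0 := ltW (a_gt0 n).
  have [lt|le] := ltP (lam' n) (lam n).
    have [y yax dy] : exists2 y, a n < y < x n &
        d * (x n - a n) <= f (g y) - g (f y).
      apply: (@bump_commutator _ f g _ _ (a n.+1) (lam n) (lam' n)) => //.
      by move: far; rewrite gtr0_norm; lra.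
    by exists y => //; apply: le_trans dy (ler_norm _).
  have [y yax dy] : exists2 y, a n < y < x n &
        d * (x n - a n) <= g (f y) - f (g y).
      apply: (@bump_commutator _ g f _ _ (a n.+1) (lam' n) (lam n)) => //.
      by move: far; rewrite ler0_norm; lra.
    by exists y => //; rewrite distrC; apply: le_trans dy (ler_norm _).
apply/negP; rewrite -ltNge.
apply: le_lt_trans (small y (lt_trans An ay)) _.
rewrite -mulrA ltr_pM2l //.
have : K^-1 * y < K^-1 * x n by rewrite ltr_pM2l ?invr_gt0; lra.
have : (1 - K^-1) * y < (1 - K^-1) * x n by rewrite ltr_pM2l.
have : a n < K^-1 * x n.
  by rewrite mulrC ltr_pdivlMr ?(mulrC _ K); [exact: xK | lra].
lra.
Unshelve. all: by end_near. Qed.
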